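(* For each $n \in \{22, 30, 31, 34, 35, 36, 40, 41\}$ there exists a $(2,4)$-regular matchstick graph with exactly $n$ vertices which has exactly two vertices of degree 2.
   Context: A matchstick graph is a finite graph drawn in the Euclidean plane such that vertices are distinct points, every edge is a straight line segment of length 1 between its endpoints, and edges do not cross or overlap (two edges intersect at most in a common endpoint). A matchstick graph is $(2,4)$-regular if every vertex has degree 2 or 4. *)

(* Defs.v *)
From Stdlib Require Import Reals Lra Lia List Arith.
Open Scope R_scope.

Definition point := (R * R)%type.

Definition dist2 (p q : point) : R :=
  (fst p - fst q) ^ 2 + (snd p - snd q) ^ 2.

Definition on_seg (x p q : point) : Prop :=
  exists t : R, 0 <= t <= 1 /\
    fst x = (1 - t) * fst p + t * fst q /\
    snd x = (1 - t) * snd p + t * snd q.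

Definition matchstick_graph (n : nat) (pos : nat -> point)
    (adj : nat -> nat -> bool) : Prop :=
  (forall i j, adj i j = true -> (i < n)%nat /\ (j < n)%nat) /\
  (forall i j, adj i j = adj j i) /\
  (forall i, adj i i = false) /\
  (forall i j, (i < n)%nat -> (j < n)%nat -> pos i = pos j -> i = j) /\
  (forall i j, adj i j = true -> dist2 (pos i) (pos j) = 1) /\
  (forall a b c d, adj a b = true -> adj c d = true ->
     ~ ((a = c /\ b = d) \/ (a = d /\ b = c)) ->
     forall x, on_seg x (pos a) (pos b) -> on_seg x (pos c) (pos d) ->
       exists v, (v = a \/ v = b) /\ (v = c \/ v = d) /\ x = pos v).

Definition degree (n : nat) (adj : nat -> nat -> bool) (i : nat) : nat :=
  length (filter (fun j => adj i j) (seq 0 n)).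

Definition regular_2_4 (n : nat) (adj : nat -> nat -> bool) : Prop :=
  forall i, (i < n)%nat -> degree n adj i = 2%nat \/ degree n adj i = 4%nat.

Definition num_deg2 (n : nat) (adj : nat -> nat -> bool) : nat :=
  length (filter (fun i => Nat.eqb (degree n adj i) 2) (seq 0 n)).

(* Main.v *)
Require Import Defs.
From Stdlib Require Import Reals List Arith.
From Stdlib Require Import ZArith Bool Lia Lra.
Import ListNotations.

(* Each graph is the union of a rigid matchstick graph H lying in a half-plane
   and of its mirror image in the boundary line, which meets H in two or three
   vertices of degree 2.  A (2,4)-regular graph with two vertices of degree 2 has
   one edge more than an isostatic framework; the mirror symmetry accounts for
   it: the equations "every edge of H has length 1" together with "the axis
   vertices have ordinate 0" and "the first axis vertex is the origin" form a
   square system of polynomials of degree at most 2 in the coordinates of H.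
   It is solved near an explicit decimal approximation by a simplified Newton
   iteration x - A F(x), where A is an approximate inverse of the Jacobian
   matrix.  Distinctness of vertices and disjointness of edges are strict
   inequalities, so they can be tested on the approximation. *)

(** * Half graphs, their constraint systems and the integer solvability test *)

Open Scope R_scope.

(* [Unit a b]: the vertices [a] and [b] are at distance 1; [Zero k]: the unknown
   number [k] vanishes.  Vertex [i] has the unknowns [2 i] (abscissa) and
   [2 i + 1] (ordinate). *)
Inductive constr := Unit (a b : nat) | Zero (k : nat).

(* The vertices numbered below [haxis] lie on the mirror axis, the line of
   ordinate 0; [hcoords] lists the approximate unknowns in units of
   [1 / scale]. *)
Record half := Half {
  hsize : nat;
  haxis : nat;
  hedges : list (nat * nat);
  hcoords : list Z }.

Definition scale : Z := 10000000.
(* The solution is within [radius / scale] of the approximation. *)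
Definition radius : Z := 1000.

Fixpoint zsum (n : nat) (f : nat -> Z) : Z :=
  match n with O => 0%Z | S m => (zsum m f + f m)%Z end.

Fixpoint zall (n : nat) (f : nat -> bool) : bool :=
  match n with O => true | S m => f m && zall m f end.

Definition hdim (g : half) : nat := 2 * hsize g.

Definition constraints (g : half) : list constr :=
  map (fun e => Unit (fst e) (snd e)) (hedges g) ++
  Zero 0 :: map (fun i => Zero (2 * i + 1)) (seq 0 (haxis g)).

Definition hcoord (g : half) (k : nat) : Z := nth k (hcoords g) 0%Z.

(* [zval] and [zlin] are [val] and [lin] below, multiplied by [scale ^ 2] and
   [scale] respectively. *)
Definition zval (c : constr) (x : nat -> Z) : Z :=
  match c with
  | Unit a b => (x (2 * a)%nat - x (2 * b)%nat) ^ 2 +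
      (x (2 * a + 1)%nat - x (2 * b + 1)%nat) ^ 2 - scale ^ 2
  | Zero k => scale * x k
  end%Z.

(** [zdelta j] is the [j]-th standard basis vector, so [zlin c m (zdelta j)] is a scaled partial
    derivative. *)
Definition zdelta (j i : nat) : Z := if Nat.eqb i j then 1%Z else 0%Z.

Definition zlin (c : constr) (m d : nat -> Z) : Z :=
  match c with
  | Unit a b =>
      2 * ((m (2 * a)%nat - m (2 * b)%nat) * (d (2 * a)%nat - d (2 * b)%nat) +
        (m (2 * a + 1)%nat - m (2 * b + 1)%nat) *
        (d (2 * a + 1)%nat - d (2 * b + 1)%nat))
  | Zero k => scale * d k
  end%Z.

Definition jacobian (g : half) : list (list Z) :=
  map (fun c => map (fun j => zlin c (hcoord g) (zdelta j)) (seq 0 (hdim g)))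
    (constraints g).

Definition entry (m : list (list Z)) (i j : nat) : Z := nth j (nth i m []) 0%Z.

(* Gauss-Jordan elimination in fixed-point arithmetic on rows [M | I]; the
   leading column is dropped once it has been cleared.  Nothing is proved about
   the result: its quality is tested afterwards. *)
Fixpoint extract_pivot (rows : list (list Z)) : list Z * list (list Z) :=
  match rows with
  | [] => ([], [])
  | [r] => (r, [])
  | r :: rs =>
      let (p, others) := extract_pivot rs in
      if (Z.abs (hd 0 p) <? Z.abs (hd 0 r))%Z then (r, p :: others)
      else (p, r :: others)
  end.

(** [p] is the pivot row already divided by its leading entry and stripped of it, hence aligned with
    [tl r]. *)
Definition clear_row (p r : list Z) : list Z :=
  let f := hd 0%Z r in
  if (f =? 0)%Z then tl r
  else map (fun xy => fst xy - f * snd xy / scale)%Z (combine (tl r) p).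

(** Pivot rows are appended to [above] in the order of the columns, so the rows of the inverse come
    out in the right order whatever rows the pivoting picks. *)
Fixpoint gauss_jordan (n : nat) (above below : list (list Z)) : list (list Z) :=
  match n with
  | O => above
  | S n' =>
      let (p, others) := extract_pivot below in
      let f := hd 0%Z p in
      let p' := map (fun x => x * scale / f)%Z (tl p) in
      gauss_jordan n' (map (clear_row p') above ++ [p']) (map (clear_row p') others)
  end.

Definition approx_inverse (n : nat) (m : list (list Z)) : list (list Z) :=
  gauss_jordan n []
    (map (fun ir => snd ir ++ map (fun j => scale * zdelta j (fst ir))%Z (seq 0 n))
      (combine (seq 0 n) m)).

(* The four tests, in order: the Jacobian varies little over the ball; the first
   Newton step is at most half the radius; [a] is nearly a left inverse of the
   Jacobian [d]; [a] is nearly a right inverse, hence injective. *)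
Definition newton_check (n : nat) (cs : list constr) (x : nat -> Z)
    (d a : nat -> nat -> Z) : bool :=
  zall n (fun i =>
    (64 * radius * zsum n (fun k => Z.abs (a i k)) <=? scale * scale)%Z &&
    (2 * Z.abs (zsum n (fun k => a i k * zval (nth k cs (Zero 0)) x)) <=?
      radius * (scale * scale))%Z &&
    (4 * zsum n (fun j =>
      Z.abs (scale * scale * zdelta j i - zsum n (fun k => a i k * d k j))) <=?
      scale * scale)%Z &&
    (2 * zsum n (fun j =>
      Z.abs (scale * scale * zdelta j i - zsum n (fun k => d i k * a k j))) <=?
      scale * scale)%Z).

Definition constr_below (n : nat) (c : constr) : bool :=
  match c with
  | Unit a b => Nat.ltb (2 * a + 1) n && Nat.ltb (2 * b + 1) n
  | Zero k => Nat.ltb k n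
  end.

Definition solvable (g : half) : bool :=
  let d := jacobian g in
  let a := approx_inverse (hdim g) d in
  Nat.eqb (length (constraints g)) (hdim g) &&
  forallb (constr_below (hdim g)) (constraints g) &&
  newton_check (hdim g) (constraints g) (hcoord g) (entry d) (entry a).

(** * Finite sums of real numbers *)

Lemma Rabs_le_inv (a b : R) : Rabs a <= b -> - b <= a <= b.
Proof. unfold Rabs; destruct (Rcase_abs a); lra. Qed.

Fixpoint rsum (n : nat) (f : nat -> R) : R :=
  match n with O => 0 | S m => rsum m f + f m end.

Lemma rsum_ext (n : nat) (f g : nat -> R) :
  (forall k, (k < n)%nat -> f k = g k) -> rsum n f = rsum n g.
Proof.
  induction n as [|n IH]; simpl; intros H; [reflexivity|].
  rewrite IH, H; auto.
Qed.

Lemma rsum_plus (n : nat) (f g : nat -> R) :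
  rsum n (fun k => f k + g k) = rsum n f + rsum n g.
Proof. induction n as [|n IH]; simpl; [|rewrite IH]; ring. Qed.

Lemma rsum_minus (n : nat) (f g : nat -> R) :
  rsum n (fun k => f k - g k) = rsum n f - rsum n g.
Proof. induction n as [|n IH]; simpl; [|rewrite IH]; ring. Qed.

Lemma rsum_scal_l (n : nat) (c : R) (f : nat -> R) :
  rsum n (fun k => c * f k) = c * rsum n f.
Proof. induction n as [|n IH]; simpl; [|rewrite IH]; ring. Qed.

Lemma rsum_scal_r (n : nat) (c : R) (f : nat -> R) :
  rsum n (fun k => f k * c) = rsum n f * c.
Proof. induction n as [|n IH]; simpl; [|rewrite IH]; ring. Qed.

Lemma rsum_0 (n : nat) : rsum n (fun _ => 0) = 0.
Proof. induction n as [|n IH]; simpl; [|rewrite IH]; ring. Qed.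

Lemma rsum_le (n : nat) (f g : nat -> R) :
  (forall k, (k < n)%nat -> f k <= g k) -> rsum n f <= rsum n g.
Proof.
  induction n as [|n IH]; simpl; intros H; [lra|].
  apply Rplus_le_compat; auto.
Qed.

Lemma rsum_abs (n : nat) (f : nat -> R) : Rabs (rsum n f) <= rsum n (fun k => Rabs (f k)).
Proof.
  induction n as [|n IH]; simpl; [rewrite Rabs_R0; lra|].
  pose proof (Rabs_triang (rsum n f) (f n)); lra.
Qed.

Lemma rsum_swap (n m : nat) (f : nat -> nat -> R) :
  rsum n (fun i => rsum m (f i)) = rsum m (fun j => rsum n (fun i => f i j)).
Proof.
  induction n as [|n IH]; simpl; [now rewrite rsum_0|].
  now rewrite IH, rsum_plus.
Qed.

Lemma rsum_abs_mul_le (n : nat) (a y : nat -> R) (D : R) :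
  (forall k, (k < n)%nat -> Rabs (y k) <= D) ->
  Rabs (rsum n (fun k => a k * y k)) <= rsum n (fun k => Rabs (a k)) * D.
Proof.
  intros H. rewrite <- rsum_scal_r.
  eapply Rle_trans; [apply rsum_abs|].
  apply rsum_le; intros k Hk. rewrite Rabs_mult.
  apply Rmult_le_compat_l; [apply Rabs_pos|auto].
Qed.

Definition delta (j i : nat) : R := if Nat.eqb i j then 1 else 0.

Lemma rsum_delta (n k : nat) (d : nat -> R) :
  (k < n)%nat -> rsum n (fun j => delta j k * d j) = d k.
Proof.
  intros Hk. induction n as [|n IH]; [lia|]. simpl. unfold delta at 2.
  destruct (Nat.eqb_spec k n) as [->|Hkn].
  - rewrite (rsum_ext _ _ (fun _ => 0)), rsum_0; [ring|].
    intros j Hj. unfold delta. destruct (Nat.eqb_spec n j); [lia|ring].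
  - rewrite IH; [ring|lia].
Qed.

(** * The constraint polynomials and their derivatives *)

Definition val (c : constr) (u : nat -> R) : R :=
  match c with
  | Unit a b => (u (2 * a)%nat - u (2 * b)%nat) ^ 2 +
      (u (2 * a + 1)%nat - u (2 * b + 1)%nat) ^ 2 - 1
  | Zero k => u k
  end.

Definition lin (c : constr) (m d : nat -> R) : R :=
  match c with
  | Unit a b =>
      2 * ((m (2 * a)%nat - m (2 * b)%nat) * (d (2 * a)%nat - d (2 * b)%nat) +
        (m (2 * a + 1)%nat - m (2 * b + 1)%nat) *
        (d (2 * a + 1)%nat - d (2 * b + 1)%nat))
  | Zero k => d k
  end.

(* The constraints have degree at most 2, so the mean value formula is exact
   at the midpoint. *)
Lemma val_sub (c : constr) (u v : nat -> R) :
  val c u - val c v = lin c (fun i => (u i + v i) / 2) (fun i => u i - v i).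
Proof. destruct c; simpl; field. Qed.

(** [lin] is linear in [d], and cutting the basis expansion of [d] at [n] loses nothing because [c]
    reads no unknown from [n] on. *)
Lemma lin_rsum (c : constr) (n : nat) (m d : nat -> R) :
  constr_below n c = true ->
  lin c m d = rsum n (fun j => lin c m (delta j) * d j).
Proof.
  intros Hc.
  assert (E : forall N, rsum N (fun j => lin c m (delta j) * d j) =
                   lin c m (fun k => rsum N (fun j => delta j k * d j))).
  { induction N as [|N IH]; simpl; [destruct c; simpl; ring|].
    rewrite IH. destruct c; simpl; ring. }
  rewrite E. destruct c as [a b|k]; simpl in Hc |- *.
  - apply andb_true_iff in Hc; destruct Hc as [Ha Hb].
    apply Nat.ltb_lt in Ha; apply Nat.ltb_lt in Hb.
    rewrite !rsum_delta by lia. reflexivity.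
  - apply Nat.ltb_lt in Hc. now rewrite rsum_delta.
Qed.

(** Lipschitz bound for the derivative. For [Unit], two products of size at most
    [(2 * r) * (2 * D)], doubled, give [16 * r * D]; the derivative of [Zero] is constant. *)
Lemma lin_close (c : constr) (n : nat) (m m0 d : nat -> R) (r D : R) :
  constr_below n c = true ->
  (forall k, (k < n)%nat -> Rabs (m k - m0 k) <= r) ->
  (forall k, (k < n)%nat -> Rabs (d k) <= D) ->
  Rabs (lin c m d - lin c m0 d) <= 16 * r * D.
Proof.
  intros Hc Hm Hd. destruct c as [a b|k]; simpl in Hc |- *.
  - apply andb_true_iff in Hc; destruct Hc as [Ha Hb].
    apply Nat.ltb_lt in Ha; apply Nat.ltb_lt in Hb.
    assert (P : forall i j, (i < n)%nat -> (j < n)%nat ->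
      Rabs (((m i - m0 i) - (m j - m0 j)) * (d i - d j)) <= (2 * r) * (2 * D)).
    { intros i j Hi Hj. rewrite Rabs_mult.
      apply Rmult_le_compat; try apply Rabs_pos.
      - pose proof (Hm i Hi); pose proof (Hm j Hj).
        pose proof (Rabs_triang (m i - m0 i) (- (m j - m0 j))).
        rewrite Rabs_Ropp in *. unfold Rminus at 1. lra.
      - pose proof (Hd i Hi); pose proof (Hd j Hj).
        pose proof (Rabs_triang (d i) (- d j)). rewrite Rabs_Ropp in *.
        unfold Rminus. lra. }
    pose proof (P (2 * a)%nat (2 * b)%nat ltac:(lia) ltac:(lia)) as P1.
    pose proof (P (2 * a + 1)%nat (2 * b + 1)%nat ltac:(lia) ltac:(lia)) as P2.
    simpl in P1, P2.
    match goal with |- Rabs ?e <= _ =>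
      match type of P1 with Rabs ?x <= _ =>
        match type of P2 with Rabs ?y <= _ => replace e with (2 * (x + y)) by ring end end end.
    rewrite Rabs_mult, (Rabs_right 2) by lra.
    eapply Rle_trans; [apply Rmult_le_compat_l, Rabs_triang; lra|]. lra.
  - apply Nat.ltb_lt in Hc. rewrite Rminus_diag, Rabs_R0.
    pose proof (Hm k Hc); pose proof (Hd k Hc).
    pose proof (Rabs_pos (m k - m0 k)); pose proof (Rabs_pos (d k)). nra.
Qed.

(** * Convergence of the simplified Newton iteration *)

Definition newton_step (n : nat) (c : nat -> constr) (A : nat -> nat -> R)
    (u : nat -> R) (i : nat) : R :=
  u i - rsum n (fun k => A i k * val (c k) u).

Definition in_ball (n : nat) (x0 : nat -> R) (r : R) (u : nat -> R) : Prop :=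
  forall k, (k < n)%nat -> Rabs (u k - x0 k) <= r.

(** Given the constant 16 of [lin_close], each condition bounds one of the two error terms of a
    Newton step by a quarter of the distance; together they make the step halve distances. *)
Definition near_inverse (n : nat) (c : nat -> constr) (x0 : nat -> R) (r : R)
    (A : nat -> nat -> R) : Prop :=
  forall i, (i < n)%nat ->
    64 * r * rsum n (fun k => Rabs (A i k)) <= 1 /\
    4 * rsum n (fun j =>
      Rabs (delta j i - rsum n (fun k => A i k * lin (c k) x0 (delta j)))) <= 1.

Lemma newton_step_contracts (n : nat) (c : nat -> constr) (x0 : nat -> R) (r : R)
    (A : nat -> nat -> R) (u v : nat -> R) (D : R) (i : nat) :
  (forall k, (k < n)%nat -> constr_below n (c k) = true) ->
  near_inverse n c x0 r A ->
  in_ball n x0 r u -> in_ball n x0 r v ->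
  (forall k, (k < n)%nat -> Rabs (u k - v k) <= D) -> (i < n)%nat ->
  Rabs (newton_step n c A u i - newton_step n c A v i) <= D / 2.
Proof.
  intros Hc HA Hu Hv HD Hi. destruct (HA i Hi) as [HA1 HA2].
  assert (D0 : 0 <= D) by (eapply Rle_trans; [apply Rabs_pos|apply (HD i Hi)]).
  set (m := fun j => (u j + v j) / 2). set (d := fun j => u j - v j).
  assert (Hm : forall k, (k < n)%nat -> Rabs (m k - x0 k) <= r).
  { intros k Hk. specialize (Hu k Hk); specialize (Hv k Hk). unfold m.
    replace ((u k + v k) / 2 - x0 k) with ((u k - x0 k + (v k - x0 k)) / 2) by field.
    apply Rabs_le_inv in Hu; apply Rabs_le_inv in Hv.
    apply Rabs_le; lra. }
  (* With [J] the Jacobian and [T] the step, [T u - T v = (I - A J(x0)) (u - v) - A (J(m) - J(x0))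
     (u - v)]; this is exact at the midpoint [m] by [val_sub]. *)
  assert (E : newton_step n c A u i - newton_step n c A v i =
    rsum n (fun j => (delta j i - rsum n (fun k => A i k * lin (c k) x0 (delta j))) * d j)
    - rsum n (fun k => A i k * (lin (c k) m d - lin (c k) x0 d))).
  { rewrite (rsum_ext n (fun j => _ * d j) (fun j => delta j i * d j -
      rsum n (fun k => A i k * (lin (c k) x0 (delta j) * d j)))).
    2:{ intros j _. rewrite Rmult_minus_distr_r, <- rsum_scal_r. f_equal.
        apply rsum_ext; intros; ring. }
    rewrite rsum_minus, rsum_delta by assumption.
    rewrite (rsum_swap n n (fun j k => A i k * (lin (c k) x0 (delta j) * d j))).
    rewrite (rsum_ext n (fun j => rsum n _) (fun k => A i k * lin (c k) x0 d)).
    2:{ intros k Hk. rewrite rsum_scal_l, <- lin_rsum; auto. }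
    rewrite (rsum_ext n (fun k => A i k * (lin (c k) m d - _))
      (fun k => (A i k * val (c k) u - A i k * val (c k) v) - A i k * lin (c k) x0 d)).
    2:{ intros k _. unfold m, d. rewrite <- val_sub. ring. }
    rewrite !rsum_minus. unfold newton_step, d. ring. }
  rewrite E. eapply Rle_trans; [apply Rabs_triang|]. rewrite Rabs_Ropp.
  pose proof (rsum_abs_mul_le n
    (fun j => delta j i - rsum n (fun k => A i k * lin (c k) x0 (delta j))) d D HD) as B1.
  pose proof (rsum_abs_mul_le n (A i) (fun k => lin (c k) m d - lin (c k) x0 d) (16 * r * D)
    ltac:(intros k Hk; apply (lin_close _ n); auto)) as B2.
  simpl in B1, B2. nra.
Qed.

(** Banach's fixed point argument in the maximum norm. It yields only [A F(u) = 0];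
    [near_inverse_injective] then removes [A]. *)
Lemma newton_step_fixed_point (n : nat) (c : nat -> constr) (x0 : nat -> R) (r : R)
    (A : nat -> nat -> R) :
  0 <= r ->
  (forall k, (k < n)%nat -> constr_below n (c k) = true) ->
  near_inverse n c x0 r A ->
  (forall i, (i < n)%nat -> 2 * Rabs (rsum n (fun k => A i k * val (c k) x0)) <= r) ->
  exists u, in_ball n x0 r u /\
    forall i, (i < n)%nat -> rsum n (fun k => A i k * val (c k) u) = 0.
Proof.
  intros Hr Hc HA H0. set (T := newton_step n c A).
  set (w := fun p => Nat.iter p T x0).
  assert (P : forall p, 0 < (/ 2) ^ p) by (intros p; apply pow_lt; lra).
  (* The induction is joint: steps are known to halve only inside the ball, and the iterates stay
     inside because the steps halve. *)
  assert (W : forall p, (forall i, (i < n)%nat -> Rabs (w p i - x0 i) <= r * (1 - (/ 2) ^ p)) /\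
                   (forall i, (i < n)%nat -> Rabs (w (S p) i - w p i) <= r / 2 * (/ 2) ^ p)).
  { induction p as [|p [IH1 IH2]].
    - split; intros i Hi; simpl.
      + rewrite Rminus_diag, Rabs_R0. lra.
      + specialize (H0 i Hi). unfold T, newton_step.
        match goal with |- Rabs ?e <= _ => replace e with
          (- rsum n (fun k => A i k * val (c k) x0)) by ring end.
        rewrite Rabs_Ropp. lra.
    - assert (B : forall i, (i < n)%nat -> Rabs (w (S p) i - x0 i) <= r * (1 - (/ 2) ^ S p)).
      { intros i Hi. specialize (IH1 i Hi); specialize (IH2 i Hi).
        replace (w (S p) i - x0 i) with ((w (S p) i - w p i) + (w p i - x0 i)) by ring.
        eapply Rle_trans; [apply Rabs_triang|].
        replace (r * (1 - (/ 2) ^ S p)) with (r / 2 * (/ 2) ^ p + r * (1 - (/ 2) ^ p));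
          [lra|simpl; field]. }
      split; [exact B|]. intros i Hi.
      replace (r / 2 * (/ 2) ^ S p) with (r / 2 * (/ 2) ^ p / 2) by (simpl; field).
      apply (newton_step_contracts n c x0 r A (w (S p)) (w p)); auto;
        intros k Hk; [eapply Rle_trans; [apply (B k Hk)|]|eapply Rle_trans; [apply (IH1 k Hk)|]].
      + pose proof (P (S p)). nra.
      + pose proof (P p). nra. }
  assert (Bw : forall p, in_ball n x0 r (w p)).
  { intros p i Hi. eapply Rle_trans; [apply (proj1 (W p) i Hi)|]. pose proof (P p). nra. }
  assert (G : forall p q i, (i < n)%nat ->
    Rabs (w (q + p)%nat i - w p i) <= r * (/ 2) ^ p * (1 - (/ 2) ^ q)).
  { intros p q i Hi. induction q as [|q IH].
    - simpl. rewrite Rminus_diag, Rabs_R0. lra.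
    - replace (w (S q + p)%nat i - w p i) with
        ((w (S (q + p)) i - w (q + p)%nat i) + (w (q + p)%nat i - w p i)) by (simpl; ring).
      eapply Rle_trans; [apply Rabs_triang|].
      pose proof (proj2 (W (q + p)%nat) i Hi) as Hs. rewrite pow_add in Hs.
      replace (r * (/ 2) ^ p * (1 - (/ 2) ^ S q)) with
        (r / 2 * ((/ 2) ^ q * (/ 2) ^ p) + r * (/ 2) ^ p * (1 - (/ 2) ^ q));
        [lra|simpl; field]. }
  assert (small : forall e, 0 < e -> exists p, r * (/ 2) ^ p < e).
  (* Dividing by [r + 1] instead of [r] covers the case [r = 0]. *)
  { intros e He. destruct (pow_lt_1_zero (/ 2)) with (y := e / (r + 1)) as [p Hp].
    - rewrite Rabs_right; lra.
    - apply Rdiv_lt_0_compat; lra.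
    - exists p. specialize (Hp p (le_n p)). rewrite Rabs_right in Hp by (pose proof (P p); lra).
      apply (Rmult_lt_compat_r (r + 1)) in Hp; [|lra].
      unfold Rdiv in Hp. rewrite Rmult_assoc, Rinv_l, Rmult_1_r in Hp by lra.
      pose proof (P p). nra. }
  (* A sigma type, so that [u] can be defined by projection; coordinates from [n] on get the value 0
     and no claim of convergence. *)
  assert (L : forall i, {l | (i < n)%nat -> Un_cv (fun p => w p i) l}).
  { intros i. destruct (lt_dec i n) as [Hi|Hi]; [|exists 0; tauto].
    destruct (R_complete (fun p => w p i)) as [l Hl]; [|exists l; auto].
    intros e He. destruct (small (e / 2)) as [p Hp]; [lra|]. exists p. intros a b Ha Hb.
    unfold Rdist.
    assert (near : forall q, (q >= p)%nat -> Rabs (w q i - w p i) < e / 2).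
    { intros q Hq. eapply Rle_lt_trans; [|apply Hp].
      replace q with ((q - p) + p)%nat by lia.
      eapply Rle_trans; [apply (G p (q - p)%nat i Hi)|].
      assert (0 <= r * (/ 2) ^ p) by (pose proof (P p); nra).
      pose proof (P (q - p)%nat). nra. }
    pose proof (near a Ha) as Na; pose proof (near b Hb) as Nb.
    apply Rabs_def2 in Na; apply Rabs_def2 in Nb. apply Rabs_def1; lra. }
  set (u := fun i => proj1_sig (L i)).
  (* The Cauchy bound [G] passes to the limit; its case [p = 0] puts [u] in the ball. *)
  assert (Hu : forall p i, (i < n)%nat -> Rabs (u i - w p i) <= r * (/ 2) ^ p).
  { intros p i Hi. apply Rle_plus_epsilon. intros e He.
    pose proof (proj2_sig (L i) Hi e He) as [M HM]. fold (u i) in HM.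
    specialize (HM (M + p)%nat ltac:(lia)). unfold Rdist in HM.
    pose proof (G p M i Hi) as HG.
    assert (0 <= r * (/ 2) ^ p) by (pose proof (P p); nra).
    pose proof (P M).
    replace (u i - w p i) with (- (w (M + p)%nat i - u i) + (w (M + p)%nat i - w p i)) by ring.
    eapply Rle_trans; [apply Rabs_triang|]. rewrite Rabs_Ropp. nra. }
  assert (Bu : in_ball n x0 r u).
  { intros i Hi. pose proof (Hu 0%nat i Hi) as H. simpl in H. lra. }
  exists u. split; [exact Bu|]. intros i Hi.
  (* [T u - u] is split at [T (w p) = w (S p)]; both parts are at most [r / 2 * (/ 2) ^ p]. *)
  assert (Z : Rabs (T u i - u i) <= 0).
  { apply Rle_plus_epsilon. intros e He. destruct (small e He) as [p Hp].
    pose proof (newton_step_contracts n c x0 r A u (w p) _ i Hc HA Bu (Bw p) (Hu p) Hi) as H1.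
    pose proof (Hu (S p) i Hi) as H2. simpl in H2.
    change (newton_step n c A (w p) i) with (w (S p) i) in H1. fold T in H1. simpl w in *.
    replace (T u i - u i) with ((T u i - T (w p) i) - (u i - T (w p) i)) by ring.
    eapply Rle_trans; [apply Rabs_triang|]. rewrite Rabs_Ropp. simpl in H1.
    fold (w p) in H2. lra. }
  assert (H : T u i - u i = 0) by (apply Rabs_le_inv in Z; lra).
  unfold T, newton_step in H. lra.
Qed.

(** If [A y = 0] then [y = (I - B A) y], where [I - B A] has norm at most one half; iterating bounds
    [y] by arbitrarily small numbers. *)
Lemma near_inverse_injective (n : nat) (A B : nat -> nat -> R) (y : nat -> R) :
  (forall l, (l < n)%nat ->
    2 * rsum n (fun k => Rabs (delta k l - rsum n (fun i => B l i * A i k))) <= 1) ->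
  (forall i, (i < n)%nat -> rsum n (fun k => A i k * y k) = 0) ->
  forall l, (l < n)%nat -> y l = 0.
Proof.
  intros HB Hy.
  assert (E : forall l, (l < n)%nat ->
    y l = rsum n (fun k => (delta k l - rsum n (fun i => B l i * A i k)) * y k)).
  { intros l Hl. rewrite (rsum_ext n _ (fun k => delta k l * y k -
      rsum n (fun i => B l i * (A i k * y k)))).
    2:{ intros k _. rewrite Rmult_minus_distr_r, <- rsum_scal_r. f_equal.
        apply rsum_ext; intros; ring. }
    rewrite rsum_minus, rsum_delta, rsum_swap by assumption.
    rewrite (rsum_ext n (fun j => rsum n _) (fun _ => 0)), rsum_0; [ring|].
    intros i Hi. rewrite rsum_scal_l, Hy; [ring|assumption]. }
  (* The sum of absolute values serves as starting bound in place of the maximum. *)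
  set (M := rsum n (fun k => Rabs (y k))).
  assert (HM : forall l, (l < n)%nat -> Rabs (y l) <= M).
  { intros l Hl. rewrite <- (rsum_delta n l y Hl). unfold M.
    eapply Rle_trans; [apply rsum_abs|]. apply rsum_le. intros k _.
    rewrite Rabs_mult. pose proof (Rabs_pos (y k)). unfold delta.
    destruct (Nat.eqb l k); [rewrite Rabs_R1|rewrite Rabs_R0]; lra. }
  assert (H : forall p l, (l < n)%nat -> Rabs (y l) <= M * (/ 2) ^ p).
  { induction p as [|p IH]; intros l Hl; [simpl; rewrite Rmult_1_r; auto|].
    rewrite (E l Hl). eapply Rle_trans; [apply (rsum_abs_mul_le n _ _ _ IH)|].
    specialize (HB l Hl). simpl.
    assert (0 <= M * (/ 2) ^ p) by (eapply Rle_trans; [apply Rabs_pos|apply (IH l Hl)]).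
    nra. }
  intros l Hl. destruct (Req_dec (y l) 0) as [|Hne]; [assumption|exfalso].
  apply Rabs_pos_lt in Hne. enough (Rabs (y l) <= 0) by lra.
   apply Rle_plus_epsilon. intros e He. rewrite Rplus_0_l.
  assert (M0 : 0 <= M) by (eapply Rle_trans; [apply Rabs_pos|apply (HM l Hl)]).
  destruct (pow_lt_1_zero (/ 2)) with (y := e / (M + 1)) as [p Hp].
  - rewrite Rabs_right; lra.
  - apply Rdiv_lt_0_compat; lra.
  - specialize (Hp p (le_n p)). assert (P : 0 < (/ 2) ^ p) by (apply pow_lt; lra).
    rewrite Rabs_right in Hp by lra.
    apply (Rmult_lt_compat_r (M + 1)) in Hp; [|lra].
    unfold Rdiv in Hp. rewrite Rmult_assoc, Rinv_l, Rmult_1_r in Hp by lra.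
    specialize (H p l Hl). nra.
Qed.

(** * From the integer tests to an exact solution *)

Lemma IZR_zsum (n : nat) (f : nat -> Z) : IZR (zsum n f) = rsum n (fun k => IZR (f k)).
Proof. induction n as [|n IH]; simpl; [reflexivity|]. now rewrite plus_IZR, IH. Qed.

Lemma zall_spec (n : nat) (f : nat -> bool) :
  zall n f = true -> forall i, (i < n)%nat -> f i = true.
Proof.
  induction n as [|n IH]; simpl; intros H i Hi; [lia|].
  apply andb_true_iff in H; destruct H as [H1 H2].
  destruct (Nat.eq_dec i n) as [->|]; [assumption|apply IH; [assumption|lia]].
Qed.

Lemma scale_pos : 0 < IZR scale.
Proof. apply IZR_lt; reflexivity. Qed.

Lemma IZR_zdelta (j i : nat) : IZR (zdelta j i) = delta j i.
Proof. unfold zdelta, delta. now destruct (Nat.eqb i j). Qed.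

Lemma IZR_zlin (c : constr) (x : nat -> Z) (j : nat) :
  IZR (zlin c x (zdelta j)) =
  IZR scale * lin c (fun k => IZR (x k) / IZR scale) (delta j).
Proof.
  pose proof scale_pos. destruct c; unfold zlin, lin;
    repeat rewrite ?mult_IZR, ?plus_IZR, ?minus_IZR, ?IZR_zdelta; [field; lra|reflexivity].
Qed.

Lemma IZR_zval (c : constr) (x : nat -> Z) :
  IZR (zval c x) = IZR scale * IZR scale * val c (fun k => IZR (x k) / IZR scale).
Proof.
  pose proof scale_pos. destruct c; unfold zval, val.
  - repeat rewrite ?Z.pow_2_r, ?mult_IZR, ?plus_IZR, ?minus_IZR. field; lra.
  - rewrite mult_IZR. field; lra.
Qed.

(** Entries of [a] and of the Jacobian carry a factor [scale], constraint values [scale ^ 2].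
    Clearing these factors turns the four tests into hypotheses of [newton_step_fixed_point] and
    [near_inverse_injective]. *)
Lemma solvable_sound (g : half) :
  solvable g = true ->
  exists u : nat -> R,
    (forall k, (k < hdim g)%nat ->
       Rabs (IZR scale * u k - IZR (hcoord g k)) <= IZR radius) /\
    (forall c, In c (constraints g) -> val c u = 0).
Proof.
  intros H. unfold solvable in H. cbv zeta in H.
  apply andb_true_iff in H; destruct H as [H HN].
  apply andb_true_iff in H; destruct H as [Hl Hb].
  apply Nat.eqb_eq in Hl. rewrite forallb_forall in Hb.
  set (a := entry (approx_inverse (hdim g) (jacobian g))) in HN.
  (* How [a] was computed is forgotten: any matrix passing the tests will do. *)
  clearbody a. set (n := hdim g) in *. set (x := hcoord g) in *.
  set (c := fun k => nth k (constraints g) (Zero 0)).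
  assert (Hd : forall i k, (i < n)%nat -> (k < n)%nat ->
    entry (jacobian g) i k = zlin (c i) x (zdelta k)).
  { intros i k Hi Hk. unfold entry, jacobian, c.
    (* [map_nth] wants the default to be an image under the mapped function; the index is in range,
       so the default may be changed. *)
    rewrite (nth_indep _ [] (map (fun j => zlin (Zero 0) x (zdelta j)) (seq 0 n)))
      by (rewrite length_map; lia).
    rewrite (map_nth (fun c0 => map (fun j => zlin c0 x (zdelta j)) (seq 0 n))).
    rewrite (nth_indep _ 0%Z (zlin (nth i (constraints g) (Zero 0)) x (zdelta 0)))
      by (rewrite length_map, length_seq; lia).
    rewrite (map_nth (fun j => zlin (nth i (constraints g) (Zero 0)) x (zdelta j))).
    now rewrite seq_nth. }
  assert (Hc : forall k, (k < n)%nat -> constr_below n (c k) = true).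
  { intros k Hk. apply Hb, nth_In. lia. }
  pose proof scale_pos as Sp. set (s := IZR scale) in *.
  set (r := IZR radius / s).
  set (A := fun i k => IZR (a i k) / s). set (x0 := fun k => IZR (x k) / s).
  assert (C : forall i, (i < n)%nat ->
    (64 * r * rsum n (fun k => Rabs (A i k)) <= 1 /\
     2 * Rabs (rsum n (fun k => A i k * val (c k) x0)) <= r) /\
    4 * rsum n (fun j =>
      Rabs (delta j i - rsum n (fun k => A i k * lin (c k) x0 (delta j)))) <= 1 /\
    2 * rsum n (fun j =>
      Rabs (delta j i - rsum n (fun k => lin (c i) x0 (delta k) * A k j))) <= 1).
  { intros i Hi. pose proof (zall_spec _ _ HN i Hi) as Q.
    apply andb_true_iff in Q; destruct Q as [Q Q4].
    apply andb_true_iff in Q; destruct Q as [Q Q3].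
    apply andb_true_iff in Q; destruct Q as [Q1 Q2].
    apply Z.leb_le, IZR_le in Q1. apply Z.leb_le, IZR_le in Q2.
    apply Z.leb_le, IZR_le in Q3. apply Z.leb_le, IZR_le in Q4.
    rewrite !mult_IZR, IZR_zsum in Q1.
    rewrite !mult_IZR, abs_IZR, IZR_zsum in Q2.
    rewrite !mult_IZR, IZR_zsum in Q3.
    rewrite !mult_IZR, IZR_zsum in Q4.
    fold s in Q1, Q2, Q3, Q4.
    assert (Ss : 0 < s * s) by nra.
    split; split.
    - unfold A, r. rewrite (rsum_ext n _ (fun k => IZR (Z.abs (a i k)) * / s)).
      2:{ intros k _. unfold Rdiv. rewrite Rabs_mult, abs_IZR, (Rabs_right (/ s)); [reflexivity|].
          left. apply Rinv_0_lt_compat; assumption. }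
      rewrite rsum_scal_r. apply (Rmult_le_reg_r (s * s)); [assumption|].
      eapply Rle_trans; [|rewrite Rmult_1_l; exact Q1]. right. field. lra.
    - unfold A, r. rewrite (rsum_ext n _ (fun k =>
        IZR (a i k * zval (nth k (constraints g) (Zero 0)) x)%Z * / (s * s * s))).
      2:{ intros k _. rewrite mult_IZR, IZR_zval. fold s x0. unfold c. field. lra. }
      rewrite rsum_scal_r, Rabs_mult, (Rabs_right (/ _)).
      2:{ left. apply Rinv_0_lt_compat. nra. }
      apply (Rmult_le_reg_r (s * s * s)); [nra|].
      eapply Rle_trans; [|eapply Rle_trans; [exact Q2|]]; right; field; lra.
    - rewrite (rsum_ext n _ (fun j => IZR (Z.abs (scale * scale * zdelta j i -
        zsum n (fun k => (a i k * entry (jacobian g) k j)%Z))) * / (s * s))).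
      2:{ intros j Hj. rewrite abs_IZR, minus_IZR, !mult_IZR, IZR_zsum, IZR_zdelta.
          fold s. rewrite (rsum_ext n (fun k => IZR (a i k * _)%Z)
            (fun k => s * s * (A i k * lin (c k) x0 (delta j)))).
          2:{ intros k Hk. rewrite Hd, mult_IZR, IZR_zlin by assumption.
              fold s x0. unfold A. field. lra. }
          rewrite rsum_scal_l, <- Rmult_minus_distr_l, Rabs_mult, (Rabs_right (s * s)) by lra.
          field. lra. }
      rewrite rsum_scal_r. apply (Rmult_le_reg_r (s * s)); [assumption|].
      eapply Rle_trans; [|rewrite Rmult_1_l; exact Q3]. right. field. lra.
    - rewrite (rsum_ext n _ (fun j => IZR (Z.abs (scale * scale * zdelta j i -
        zsum n (fun k => (entry (jacobian g) i k * a k j)%Z))) * / (s * s))).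
      2:{ intros j Hj. rewrite abs_IZR, minus_IZR, !mult_IZR, IZR_zsum, IZR_zdelta.
          fold s. rewrite (rsum_ext n (fun k => IZR (_ * a k j)%Z)
            (fun k => s * s * (lin (c i) x0 (delta k) * A k j))).
          2:{ intros k Hk. rewrite Hd, mult_IZR, IZR_zlin by assumption.
              fold s x0. unfold A. field. lra. }
          rewrite rsum_scal_l, <- Rmult_minus_distr_l, Rabs_mult, (Rabs_right (s * s)) by lra.
          field. lra. }
      rewrite rsum_scal_r. apply (Rmult_le_reg_r (s * s)); [assumption|].
      eapply Rle_trans; [|rewrite Rmult_1_l; exact Q4]. right. field. lra. }
  destruct (newton_step_fixed_point n c x0 r A) as [u [Bu Fu]]; auto.
  - unfold r. apply Rle_mult_inv_pos; [apply IZR_le; discriminate|assumption].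
  - intros i Hi. destruct (C i Hi) as [[? ?] [? ?]]. auto.
  - intros i Hi. apply C; assumption.
  - exists u. split.
    + intros k Hk. specialize (Bu k Hk). unfold x0, r in Bu.
      replace (s * u k - IZR (x k)) with (s * (u k - IZR (x k) / s)) by (field; lra).
      rewrite Rabs_mult, (Rabs_right s) by lra.
      apply (Rmult_le_compat_l s) in Bu; [|lra].
      eapply Rle_trans; [exact Bu|]. right. field. lra.
    + intros c' Hc'. destruct (In_nth _ _ (Zero 0) Hc') as [k [Hk <-]].
      (* The Jacobian at the approximation takes the place of [B], by the fourth test. *)
      apply (near_inverse_injective n A (fun l i => lin (c l) x0 (delta i))
        (fun k => val (c k) u)); [|exact Fu|lia].
      intros l Hln. apply C; assumption.
Qed.

(** * Separation of segments in the plane *)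

(** Twice the signed area of the triangle [p q t]: its sign tells on which side of the line [p q]
    the point [t] lies. *)
Definition cross (p q t : point) : R :=
  (fst q - fst p) * (snd t - snd p) - (snd q - snd p) * (fst t - fst p).

Definition dot (p q t : point) : R :=
  (fst q - fst p) * (fst t - fst p) + (snd q - snd p) * (snd t - snd p).

Lemma on_seg_sym (x p q : point) : on_seg x p q -> on_seg x q p.
Proof. intros [t [Ht [E1 E2]]]. exists (1 - t). split; [lra|split; lra]. Qed.

Lemma cross_on_seg_base (p q x : point) : on_seg x p q -> cross p q x = 0.
Proof.
  intros [t [Ht [E1 E2]]]. unfold cross. rewrite E1, E2. ring.
Qed.

Lemma cross_on_seg (p q s t x : point) (e : R) :
  on_seg x s t -> 0 < e * cross p q s -> 0 < e * cross p q t -> 0 < e * cross p q x.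
Proof.
  intros [l [Hl [E1 E2]]] Hs Ht.
  replace (e * cross p q x) with ((1 - l) * (e * cross p q s) + l * (e * cross p q t))
    by (unfold cross; rewrite E1, E2; ring).
  (* One of the two weights is at least one half, which keeps the sum strictly positive. *)
  destruct (Rle_lt_dec l (/ 2)); nra.
Qed.

Lemma same_side_disjoint (p q s t x : point) (e : R) :
  0 < e * cross p q s -> 0 < e * cross p q t ->
  on_seg x p q -> on_seg x s t -> False.
Proof.
  intros Hs Ht H1 H2. pose proof (cross_on_seg p q s t x e H2 Hs Ht) as H.
  rewrite (cross_on_seg_base p q x H1) in H. lra.
Qed.

Lemma common_endpoint_cross (p q t x : point) :
  cross p q t <> 0 -> on_seg x p q -> on_seg x p t -> x = p.
Proof.
  intros H H1 [l [Hl [E1 E2]]]. pose proof (cross_on_seg_base p q x H1) as E.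
  assert (E' : l * cross p q t = 0).
  { rewrite <- E. unfold cross. rewrite E1, E2. ring. }
  apply Rmult_integral in E'. destruct E' as [->|]; [|contradiction].
  destruct x as [x1 x2], p as [p1 p2]; simpl in *. f_equal; lra.
Qed.

(** A second common point would put [q] and [t] in the same direction from [p], against the negative
    inner product. This serves consecutive edges on one line, where the cross product vanishes. *)
Lemma common_endpoint_dot (p q t x : point) :
  dot p q t < 0 -> on_seg x p q -> on_seg x p t -> x = p.
Proof.
  intros H [k [Hk [F1 F2]]] [l [Hl [E1 E2]]].
  destruct x as [x1 x2], p as [p1 p2], q as [q1 q2], t as [t1 t2].
  unfold dot in H; simpl in *.
  set (a := q1 - p1) in *. set (b := q2 - p2) in *.
  set (c := t1 - p1) in *. set (d := t2 - p2) in *.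
  assert (G1 : l * c = k * a) by (unfold a, c; lra).
  assert (G2 : l * d = k * b) by (unfold b, d; lra).
  assert (G : k * (a * a + b * b) = l * (a * c + b * d)).
  { replace (l * (a * c + b * d)) with (a * (l * c) + b * (l * d)) by ring.
    rewrite G1, G2. ring. }
  assert (L : l = 0) by nra.
  subst l. f_equal; lra.
Qed.

(** The perpendicular to [p q] at [q] separates the segments; this covers disjoint edges on one
    line, which no cross product separates. *)
Lemma beyond_disjoint (p q s t x : point) :
  dot q p s < 0 -> dot q p t < 0 -> on_seg x p q -> on_seg x s t -> False.
Proof.
  intros Hs Ht [k [Hk [F1 F2]]] [l [Hl [E1 E2]]].
  assert (H1 : dot q p x = (1 - k) * dot q p p)
    by (unfold dot; rewrite F1, F2; ring).
  assert (H2 : dot q p x = (1 - l) * dot q p s + l * dot q p t)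
    by (unfold dot; rewrite E1, E2; ring).
  assert (H3 : 0 <= dot q p p) by (apply Rplus_le_le_0_compat; apply Rle_0_sqr).
  assert (H4 : 0 <= (1 - k) * dot q p p) by (apply Rmult_le_pos; lra).
  rewrite <- H1, H2 in H4. clear H1 H2 H3.
  destruct (Rle_lt_dec l (/ 2)); nra.
Qed.

(** * Sign tests on approximate coordinates *)

Definition znear (p : point) (P : Z * Z) : Prop :=
  Rabs (IZR scale * fst p - IZR (fst P)) <= IZR radius /\
  Rabs (IZR scale * snd p - IZR (snd P)) <= IZR radius.

Definition zcross (P Q T : Z * Z) : Z :=
  ((fst Q - fst P) * (snd T - snd P) - (snd Q - snd P) * (fst T - fst P))%Z.

Definition zdot (P Q T : Z * Z) : Z :=
  ((fst Q - fst P) * (fst T - fst P) + (snd Q - snd P) * (snd T - snd P))%Z.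

(* Bounds the error of [zcross] and [zdot] when the entries are perturbed by
   at most [radius]. *)
Definition slack (P Q T : Z * Z) : Z :=
  (2 * radius * (Z.abs (fst Q - fst P) + Z.abs (snd Q - snd P) +
     Z.abs (fst T - fst P) + Z.abs (snd T - snd P)) + 8 * radius * radius)%Z.

Lemma perturbed_product (x X y Y e : R) :
  Rabs (x - X) <= e -> Rabs (y - Y) <= e ->
  Rabs (x * y - X * Y) <= e * (Rabs X + Rabs Y) + e * e.
Proof.
  intros Hx Hy.
  replace (x * y - X * Y) with (X * (y - Y) + (x - X) * Y + (x - X) * (y - Y)) by ring.
  pose proof (Rabs_triang (X * (y - Y) + (x - X) * Y) ((x - X) * (y - Y))).
  pose proof (Rabs_triang (X * (y - Y)) ((x - X) * Y)).
  rewrite !Rabs_mult in *.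
  pose proof (Rabs_pos X); pose proof (Rabs_pos Y).
  pose proof (Rabs_pos (x - X)); pose proof (Rabs_pos (y - Y)). nra.
Qed.

Lemma perturbed_difference (x X y Y e : R) :
  Rabs (x - X) <= e -> Rabs (y - Y) <= e -> Rabs ((x - y) - (X - Y)) <= 2 * e.
Proof.
  intros Hx Hy. apply Rabs_le_inv in Hx; apply Rabs_le_inv in Hy. apply Rabs_le; lra.
Qed.

(** Coordinate differences are off by at most [2 * radius], so a product of two is off by at most
    [2 * radius] times the sum of their absolute values, plus [4 * radius * radius]. Both forms
    consist of two products of the same four differences, hence a common [slack]. *)
Lemma zcross_zdot_near (p q t : point) (P Q T : Z * Z) :
  znear p P -> znear q Q -> znear t T ->
  Rabs (IZR scale * IZR scale * cross p q t - IZR (zcross P Q T)) <= IZR (slack P Q T) /\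
  Rabs (IZR scale * IZR scale * dot p q t - IZR (zdot P Q T)) <= IZR (slack P Q T).
Proof.
  intros [P1 P2] [Q1 Q2] [T1 T2].
  pose proof (perturbed_difference _ _ _ _ _ Q1 P1) as A1.
  pose proof (perturbed_difference _ _ _ _ _ Q2 P2) as A2.
  pose proof (perturbed_difference _ _ _ _ _ T1 P1) as B1.
  pose proof (perturbed_difference _ _ _ _ _ T2 P2) as B2.
  pose proof (perturbed_product _ _ _ _ _ A1 B2) as M12.
  pose proof (perturbed_product _ _ _ _ _ A2 B1) as M21.
  pose proof (perturbed_product _ _ _ _ _ A1 B1) as M11.
  pose proof (perturbed_product _ _ _ _ _ A2 B2) as M22.
  unfold slack, zcross, zdot, cross, dot.
  repeat rewrite ?plus_IZR, ?minus_IZR, ?mult_IZR, ?abs_IZR.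
  apply Rabs_le_inv in M12; apply Rabs_le_inv in M21.
  apply Rabs_le_inv in M11; apply Rabs_le_inv in M22.
  clear P1 P2 Q1 Q2 T1 T2 A1 A2 B1 B2.
  split; apply Rabs_le; nra.
Qed.

Definition zleft (P Q T : Z * Z) : bool := (slack P Q T <? zcross P Q T)%Z.
Definition zright (P Q T : Z * Z) : bool := (slack P Q T <? - zcross P Q T)%Z.

Lemma zleft_sound (p q t : point) (P Q T : Z * Z) :
  znear p P -> znear q Q -> znear t T -> zleft P Q T = true -> 0 < 1 * cross p q t.
Proof.
  intros Hp Hq Ht H. apply Z.ltb_lt, IZR_lt in H.
  destruct (zcross_zdot_near p q t P Q T Hp Hq Ht) as [C _].
  apply Rabs_le_inv in C. pose proof scale_pos.
  apply (Rmult_lt_reg_l (IZR scale * IZR scale)); nra.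
Qed.

Lemma zright_sound (p q t : point) (P Q T : Z * Z) :
  znear p P -> znear q Q -> znear t T -> zright P Q T = true -> 0 < (-1) * cross p q t.
Proof.
  intros Hp Hq Ht H. apply Z.ltb_lt, IZR_lt in H. rewrite opp_IZR in H.
  destruct (zcross_zdot_near p q t P Q T Hp Hq Ht) as [C _].
  apply Rabs_le_inv in C. pose proof scale_pos.
  apply (Rmult_lt_reg_l (IZR scale * IZR scale)); nra.
Qed.

Definition zopposite (P Q T : Z * Z) : bool := (zdot P Q T + slack P Q T <? 0)%Z.

Lemma zopposite_sound (p q t : point) (P Q T : Z * Z) :
  znear p P -> znear q Q -> znear t T -> zopposite P Q T = true -> dot p q t < 0.
Proof.
  intros Hp Hq Ht H. apply Z.ltb_lt, IZR_lt in H. rewrite plus_IZR in H.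
  destruct (zcross_zdot_near p q t P Q T Hp Hq Ht) as [_ C].
  apply Rabs_le_inv in C. pose proof scale_pos.
  apply (Rmult_lt_reg_l (IZR scale * IZR scale)); nra.
Qed.

(** Nondegenerate segments from one point overlap only if they have the same direction; a nonzero
    cross product or a negative inner product excludes this. *)
Definition fan_check (P Q T : Z * Z) : bool :=
  zleft P Q T || zright P Q T || zopposite P Q T.

Lemma fan_check_sound (p q t x : point) (P Q T : Z * Z) :
  znear p P -> znear q Q -> znear t T -> fan_check P Q T = true ->
  on_seg x p q -> on_seg x p t -> x = p.
Proof.
  intros Hp Hq Ht H. unfold fan_check in H.
  apply orb_true_iff in H; destruct H as [H|H]; [apply orb_true_iff in H; destruct H as [H|H]|].
  - apply common_endpoint_cross.
    pose proof (zleft_sound _ _ _ _ _ _ Hp Hq Ht H). lra.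
  - apply common_endpoint_cross.
    pose proof (zright_sound _ _ _ _ _ _ Hp Hq Ht H). lra.
  - apply common_endpoint_dot. eapply zopposite_sound; eauto.
Qed.

(** The candidates are the two sides of the line [P Q] and the perpendiculars at [Q] and at [P]. The
    test is not symmetric in the two segments, so [edge_pair_check] tries both orders. *)
Definition side_check (P Q S T : Z * Z) : bool :=
  (zleft P Q S && zleft P Q T) || (zright P Q S && zright P Q T) ||
  (zopposite Q P S && zopposite Q P T) || (zopposite P Q S && zopposite P Q T).

Lemma side_check_sound (p q s t x : point) (P Q S T : Z * Z) :
  znear p P -> znear q Q -> znear s S -> znear t T -> side_check P Q S T = true ->
  on_seg x p q -> on_seg x s t -> False.
Proof.
  intros Hp Hq Hs Ht H. unfold side_check in H.
  repeat (apply orb_true_iff in H; destruct H as [H|H]);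
    apply andb_true_iff in H; destruct H as [H1 H2].
  - apply (same_side_disjoint p q s t x 1); eapply zleft_sound; eauto.
  - apply (same_side_disjoint p q s t x (-1)); eapply zright_sound; eauto.
  - apply beyond_disjoint; eapply zopposite_sound; eauto.
  - intros Hx. apply on_seg_sym in Hx. revert Hx.
    apply beyond_disjoint; eapply zopposite_sound; eauto.
Qed.

(** * Pairs of edges *)

(** The conclusion of the planarity clause of [matchstick_graph], isolated so that edges can be
    exchanged and reversed. *)
Definition meet_at_ends (p : nat -> point) (a b c d : nat) : Prop :=
  forall x, on_seg x (p a) (p b) -> on_seg x (p c) (p d) ->
  exists v, (v = a \/ v = b) /\ (v = c \/ v = d) /\ x = p v.

Lemma meet_at_ends_sym (p : nat -> point) (a b c d : nat) :
  meet_at_ends p a b c d -> meet_at_ends p c d a b.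
Proof. intros H x Hx Hy. destruct (H x Hy Hx) as [v Hv]. exists v. tauto. Qed.

Lemma meet_at_ends_swap (p : nat -> point) (a b c d : nat) :
  meet_at_ends p a b c d -> meet_at_ends p b a c d.
Proof.
  intros H x Hx Hy. destruct (H x (on_seg_sym _ _ _ Hx) Hy) as [v Hv]. exists v. tauto.
Qed.

(** Coordinates travel with the edge, so they are looked up once per edge and not once per pair. *)
Definition located_edge : Type := ((nat * nat) * ((Z * Z) * (Z * Z)))%type.

(** A shared endpoint selects the fan test at that vertex. Equal or reversed edges pass, as the
    planarity clause excludes them. *)
Definition edge_pair_check (e f : located_edge) : bool :=
  let '((a, b), (A, B)) := e in
  let '((c, d), (C, D)) := f in
  if Nat.eqb a c then Nat.eqb b d || fan_check A B D
  else if Nat.eqb a d then Nat.eqb b c || fan_check A B C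
  else if Nat.eqb b c then fan_check B A D
  else if Nat.eqb b d then fan_check B A C
  else side_check A B C D || side_check C D A B.

Definition locate (P : nat -> Z * Z) (e : nat * nat) : located_edge :=
  (e, (P (fst e), P (snd e))).

Lemma edge_pair_check_sound (n : nat) (p : nat -> point) (P : nat -> Z * Z)
    (a b c d : nat) :
  (forall i, (i < n)%nat -> znear (p i) (P i)) ->
  (a < n)%nat -> (b < n)%nat -> (c < n)%nat -> (d < n)%nat ->
  edge_pair_check (locate P (a, b)) (locate P (c, d)) = true ->
  ~ ((a = c /\ b = d) \/ (a = d /\ b = c)) ->
  meet_at_ends p a b c d.
Proof.
  intros Hn Ha Hb Hc Hd H Hne x Hx Hy. unfold edge_pair_check in H; simpl in H.
  destruct (Nat.eqb_spec a c) as [->|_].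
  { destruct (Nat.eqb_spec b d) as [->|_]; [tauto|].
    exists c. repeat split; auto.
    apply (fan_check_sound (p c) (p b) (p d) x (P c) (P b) (P d)); auto. }
  destruct (Nat.eqb_spec a d) as [->|_].
  { destruct (Nat.eqb_spec b c) as [->|_]; [tauto|].
    exists d. repeat split; auto.
    apply (fan_check_sound (p d) (p b) (p c) x (P d) (P b) (P c)); auto.
    now apply on_seg_sym. }
  destruct (Nat.eqb_spec b c) as [->|_].
  { exists c. repeat split; auto.
    apply (fan_check_sound (p c) (p a) (p d) x (P c) (P a) (P d)); auto.
    now apply on_seg_sym. }
  destruct (Nat.eqb_spec b d) as [->|_].
  { exists d. repeat split; auto.
    apply (fan_check_sound (p d) (p a) (p c) x (P d) (P a) (P c)); auto;
      now apply on_seg_sym. }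
  exfalso. apply orb_true_iff in H; destruct H as [H|H].
  - apply (side_check_sound (p a) (p b) (p c) (p d) x (P a) (P b) (P c) (P d)); auto.
  - apply (side_check_sound (p c) (p d) (p a) (p b) x (P c) (P d) (P a) (P b)); auto.
Qed.

Fixpoint all_pairs {A : Type} (f : A -> A -> bool) (l : list A) : bool :=
  match l with [] => true | x :: l' => forallb (f x) l' && all_pairs f l' end.

(** Each pair of positions is tested in one order only and [f] need not be symmetric, hence the
    three alternatives. *)
Lemma all_pairs_spec (A : Type) (f : A -> A -> bool) (l : list A) (x y : A) :
  all_pairs f l = true -> In x l -> In y l -> x = y \/ f x y = true \/ f y x = true.
Proof.
  induction l as [|z l IH]; simpl; [tauto|].
  intros H. apply andb_true_iff in H; destruct H as [H1 H2].
  rewrite forallb_forall in H1.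
  intros [->|Hx] [->|Hy]; auto.
Qed.

Definition distinct_check (P Q : Z * Z) : bool :=
  (2 * radius <? Z.abs (fst P - fst Q))%Z || (2 * radius <? Z.abs (snd P - snd Q))%Z.

Lemma distinct_check_sound (p q : point) (P Q : Z * Z) :
  znear p P -> znear q Q -> distinct_check P Q = true -> p <> q.
Proof.
  intros [P1 P2] [Q1 Q2] H ->. unfold distinct_check in H.
  pose proof (perturbed_difference _ _ _ _ _ P1 Q1) as D1.
  pose proof (perturbed_difference _ _ _ _ _ P2 Q2) as D2.
  rewrite Rminus_diag, Rminus_0_l, Rabs_Ropp in D1, D2.
  apply orb_true_iff in H; destruct H as [H|H]; apply Z.ltb_lt, IZR_lt in H;
    rewrite mult_IZR, abs_IZR, minus_IZR in H; lra.
Qed.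

(** * Doubling a half graph by reflection *)

Definition vertices (g : half) : nat := 2 * hsize g - haxis g.

(* Mirror image of a vertex [i < hsize g]; the vertices from [hsize g] on are
   the images of those off the axis. *)
Definition mirror (g : half) (i : nat) : nat :=
  if Nat.ltb i (haxis g) then i else i + (hsize g - haxis g).

Definition swap (e : nat * nat) : nat * nat := (snd e, fst e).

(** Holds one orientation per edge, which keeps the number of pairwise tests low; [edges] adds the
    reverses. *)
Definition half_edges (g : half) : list (nat * nat) :=
  hedges g ++ map (fun e => (mirror g (fst e), mirror g (snd e))) (hedges g).

Definition edges (g : half) : list (nat * nat) :=
  half_edges g ++ map swap (half_edges g).

Definition adjacent (g : half) (i j : nat) : bool :=
  existsb (fun e => Nat.eqb (fst e) i && Nat.eqb (snd e) j) (edges g).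

(** Generic in the coordinates, so that the integer approximation and the real solution are
    reflected by the same formula. *)
Definition place {A : Type} (opp : A -> A) (g : half) (x : nat -> A) (i : nat) : A * A :=
  if Nat.ltb i (hsize g) then (x (2 * i)%nat, x (2 * i + 1)%nat)
  else let j := (i - (hsize g - haxis g))%nat in (x (2 * j)%nat, opp (x (2 * j + 1)%nat)).

Definition planar_check (g : half) : bool :=
  let P := place Z.opp g (hcoord g) in
  let n := vertices g in
  Nat.leb (haxis g) (hsize g) &&
  forallb (fun e => Nat.ltb (fst e) (hsize g) && Nat.ltb (snd e) (hsize g)) (hedges g) &&
  forallb (fun e => Nat.ltb (fst e) n && Nat.ltb (snd e) n &&
    negb (Nat.eqb (fst e) (snd e))) (edges g) &&
  zall n (fun i => zall i (fun j => distinct_check (P i) (P j))) &&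
  all_pairs edge_pair_check (map (locate P) (half_edges g)).

Definition degree_check (g : half) : bool :=
  let n := vertices g in
  let ds := map (degree n (adjacent g)) (seq 0 n) in
  forallb (fun d => Nat.eqb d 2 || Nat.eqb d 4) ds &&
  Nat.eqb (length (filter (fun d => Nat.eqb d 2) ds)) 2.

Lemma adjacent_edge (g : half) (i j : nat) :
  adjacent g i j = true <-> In (i, j) (edges g).
Proof.
  unfold adjacent. rewrite existsb_exists. split.
  - intros [[a b] [H E]]. simpl in E. apply andb_true_iff in E; destruct E as [E1 E2].
    apply Nat.eqb_eq in E1; apply Nat.eqb_eq in E2. now subst.
  - intros H. exists (i, j). simpl. now rewrite !Nat.eqb_refl.
Qed.

Lemma edges_sym (g : half) (i j : nat) : In (i, j) (edges g) -> In (j, i) (edges g).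
Proof.
  unfold edges. rewrite !in_app_iff, !in_map_iff. intros [H|[[a b] [E H]]].
  - right. now exists (i, j).
  - left. unfold swap in E; simpl in E. now injection E as -> ->.
Qed.

(** An axis vertex is its own image: the constraint [Zero (2 * i + 1)] makes its ordinate equal to
    its opposite. *)
Lemma place_mirror (g : half) (u : nat -> R) (i : nat) :
  (haxis g <= hsize g)%nat -> (i < hsize g)%nat ->
  (forall c, In c (constraints g) -> val c u = 0) ->
  place Ropp g u (mirror g i) = (u (2 * i)%nat, - u (2 * i + 1)%nat).
Proof.
  intros Hg Hi Hu. unfold mirror, place.
  destruct (Nat.ltb_spec i (haxis g)) as [Hx|Hx].
  - destruct (Nat.ltb_spec i (hsize g)); [|lia].
    assert (E : u (2 * i + 1)%nat = 0).
    { apply (Hu (Zero (2 * i + 1))). unfold constraints.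
      apply in_app_iff. right. right.
      apply (in_map (fun i => Zero (2 * i + 1))). apply in_seq. lia. }
    rewrite E. f_equal. ring.
  - destruct (Nat.ltb_spec (i + (hsize g - haxis g)) (hsize g)); [lia|].
    replace (i + (hsize g - haxis g) - (hsize g - haxis g))%nat with i by lia. reflexivity.
Qed.

Lemma half_edges_unit (g : half) (u : nat -> R) (i j : nat) :
  (haxis g <= hsize g)%nat ->
  (forall e, In e (hedges g) -> (fst e < hsize g)%nat /\ (snd e < hsize g)%nat) ->
  (forall c, In c (constraints g) -> val c u = 0) ->
  In (i, j) (half_edges g) ->
  dist2 (place Ropp g u i) (place Ropp g u j) = 1.
Proof.
  intros Hg He Hu H. unfold half_edges in H. apply in_app_iff in H.
  assert (U : forall a b, In (a, b) (hedges g) -> val (Unit a b) u = 0).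
  { intros a b Hab. apply Hu. unfold constraints. apply in_app_iff. left.
    apply (in_map (fun e => Unit (fst e) (snd e)) _ _ Hab). }
  destruct H as [H|H].
  - destruct (He _ H) as [Hi Hj]; simpl in Hi, Hj. specialize (U _ _ H). simpl in U.
    unfold place. destruct (Nat.ltb_spec i (hsize g)); [|lia].
    destruct (Nat.ltb_spec j (hsize g)); [|lia].
    unfold dist2; simpl fst; simpl snd. simpl in *. lra.
  - apply in_map_iff in H. destruct H as [[a b] [E H]]. injection E as <- <-.
    destruct (He _ H) as [Hi Hj]; simpl in Hi, Hj |- *. specialize (U _ _ H). simpl in U.
    rewrite !place_mirror by assumption. unfold dist2; simpl fst; simpl snd.
    simpl in *. lra.
Qed.

Lemma dist2_sym (p q : point) : dist2 p q = dist2 q p.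
Proof. unfold dist2. ring. Qed.

(** Unit lengths come from the exact solution, distinctness and planarity from its approximation,
    and degrees from the edge list alone. *)
Lemma half_realizes (g : half) :
  solvable g && planar_check g && degree_check g = true ->
  exists (pos : nat -> point) (adj : nat -> nat -> bool),
    matchstick_graph (vertices g) pos adj /\ regular_2_4 (vertices g) adj /\
    num_deg2 (vertices g) adj = 2%nat.
Proof.
  intros H. apply andb_true_iff in H; destruct H as [H HD].
  apply andb_true_iff in H; destruct H as [HS HP].
  destruct (solvable_sound g HS) as [u [Hnear Hu]].
  unfold planar_check in HP. cbv zeta in HP.
  apply andb_true_iff in HP; destruct HP as [HP Hpair].
  apply andb_true_iff in HP; destruct HP as [HP Hdist].
  apply andb_true_iff in HP; destruct HP as [HP Hrange].
  apply andb_true_iff in HP; destruct HP as [Hax Hhalf].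
  apply Nat.leb_le in Hax.
  rewrite forallb_forall in Hhalf, Hrange.
  set (P := place Z.opp g (hcoord g)) in *. set (p := place Ropp g u).
  set (n := vertices g) in *.
  assert (Hp : forall i, (i < n)%nat -> znear (p i) (P i)).
  { intros i Hi. unfold n, vertices in Hi. unfold p, P, place.
    destruct (Nat.ltb_spec i (hsize g)); unfold znear; simpl fst; simpl snd.
    - split; apply Hnear; unfold hdim; lia.
    - split; [apply Hnear; unfold hdim; lia|].
      rewrite opp_IZR.
      match goal with |- Rabs (_ * - u ?k - _) <= _ =>
        replace (IZR scale * - u k - - IZR (hcoord g k)) with
          (- (IZR scale * u k - IZR (hcoord g k))) by ring end.
      rewrite Rabs_Ropp. apply Hnear; unfold hdim; lia. }
  assert (R : forall i j, adjacent g i j = true ->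
    ((i < n)%nat /\ (j < n)%nat) /\ i <> j).
  { intros i j Hij. apply adjacent_edge, Hrange in Hij. simpl in Hij.
    apply andb_true_iff in Hij; destruct Hij as [Hij H3].
    apply andb_true_iff in Hij; destruct Hij as [H1 H2].
    apply Nat.ltb_lt in H1; apply Nat.ltb_lt in H2.
    apply negb_true_iff, Nat.eqb_neq in H3. auto. }
  assert (D : forall i j, (j < i)%nat -> (i < n)%nat -> p i <> p j).
  { intros i j Hj Hi.
    pose proof (zall_spec _ _ (zall_spec _ _ Hdist i Hi) j Hj) as E.
    apply (distinct_check_sound _ _ (P i) (P j)); [apply Hp; lia|apply Hp; lia|exact E]. }
  assert (M : forall a b c d, In (a, b) (half_edges g) -> In (c, d) (half_edges g) ->
    ~ ((a = c /\ b = d) \/ (a = d /\ b = c)) -> meet_at_ends p a b c d).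
  { intros a b c d Hab Hcd Hne.
    destruct (R a b) as [[? ?] _]; [apply adjacent_edge, in_app_iff; auto|].
    destruct (R c d) as [[? ?] _]; [apply adjacent_edge, in_app_iff; auto|].
    destruct (all_pairs_spec _ _ _ _ _ Hpair (in_map (locate P) _ _ Hab)
      (in_map (locate P) _ _ Hcd)) as [E|[E|E]].
    - injection E as -> ->. tauto.
    - now apply (edge_pair_check_sound n p P).
    - apply meet_at_ends_sym, (edge_pair_check_sound n p P); auto.
      intros [[-> ->]|[-> ->]]; apply Hne; auto. }
  exists p, (adjacent g). repeat split.
  - apply (R i j); assumption.
  - apply (R i j); assumption.
  - intros i j. apply eq_true_iff_eq. rewrite !adjacent_edge.
    split; apply edges_sym.
  - intros i. destruct (adjacent g i i) eqn:E; [|reflexivity].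
    destruct (R i i E); congruence.
  - intros i j Hi Hj E. destruct (lt_eq_lt_dec i j) as [[L|L]|L]; [|assumption|].
    + exfalso. now apply (D j i L Hj).
    + exfalso. now apply (D i j L Hi).
  - intros i j Hij. apply adjacent_edge in Hij. unfold edges in Hij.
    assert (He : forall e, In e (hedges g) -> (fst e < hsize g)%nat /\ (snd e < hsize g)%nat).
    { intros e Hin. apply Hhalf in Hin. apply andb_true_iff in Hin.
      destruct Hin as [H1 H2]. now apply Nat.ltb_lt in H1; apply Nat.ltb_lt in H2. }
    apply in_app_iff in Hij; destruct Hij as [Hij|Hij].
    + now apply half_edges_unit.
    + apply in_map_iff in Hij. destruct Hij as [[a b] [E Hin]].
      injection E as <- <-. simpl. rewrite dist2_sym. now apply half_edges_unit.
  - intros a b c d Hab Hcd Hne. change (meet_at_ends p a b c d).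
    assert (U : forall i j, adjacent g i j = true ->
      In (i, j) (half_edges g) \/ In (j, i) (half_edges g)).
    { intros i j Hij. apply adjacent_edge, in_app_iff in Hij.
      destruct Hij as [Hij|Hij]; [auto|]. apply in_map_iff in Hij.
      destruct Hij as [[k l] [E Hin]]. injection E as <- <-. auto. }
    (* Each of the two edges may be listed in either orientation; reversals reduce the four cases to
       [M]. *)
    destruct (U a b Hab) as [Hab'|Hab'], (U c d Hcd) as [Hcd'|Hcd'].
    + apply M; auto.
    + apply meet_at_ends_sym, meet_at_ends_swap, meet_at_ends_sym, M; auto; tauto.
    + apply meet_at_ends_swap, M; auto; tauto.
    + apply meet_at_ends_swap, meet_at_ends_sym, meet_at_ends_swap, meet_at_ends_sym, M;
        auto; tauto.
  - intros i Hi. unfold degree_check in HD. cbv zeta in HD.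
    apply andb_true_iff in HD; destruct HD as [HD _]. rewrite forallb_forall in HD.
    assert (E : In (degree n (adjacent g) i) (map (degree n (adjacent g)) (seq 0 n)))
      by (apply in_map, in_seq; lia).
    apply HD, orb_true_iff in E.
    destruct E as [E|E]; apply Nat.eqb_eq in E; auto.
  - unfold degree_check in HD. cbv zeta in HD.
    apply andb_true_iff in HD; destruct HD as [_ HD]. apply Nat.eqb_eq in HD.
    rewrite <- HD. unfold num_deg2. fold n.
    (* Filtering the vertices and filtering their list of degrees give equal lengths, by induction
       on an arbitrary list. *)
    generalize (seq 0 n). intros l. induction l as [|i l IH]; [reflexivity|].
    simpl. destruct (Nat.eqb (degree n (adjacent g) i) 2); simpl; congruence.
Qed.

(** * The eight half graphs and their certification *)

(** In each half graph the axis vertices have degree 2, hence degree 4 after doubling. A single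
    vertex off the axis has degree 2, and it yields the required two together with its image.
    Counting degrees then gives [2 * hsize - haxis - 1] edges, just what makes the constraint system
    square. *)
Definition half22 : half := Half 12 2
  [(0,2); (0,4); (1,8); (1,11); (2,3); (2,4); (2,5); (3,5); (3,6); (3,7); (4,5); (4,8);
   (5,8); (6,7); (6,9); (6,10); (7,10); (7,11); (8,11); (9,10); (10,11)]%nat
  [0; 0; 29755843; 0; 4200856; 9074845; 8401711; 18149690; 9959474; 899375; 14160330;
   9974220; 16680843; 23758253; 17398435; 13784033; 19918948; 1798750; 24959975; 29366815;
   25677567; 19392596; 26395159; 9418376]%Z.

Definition half30 : half := Half 16 2
  [(0,2); (0,5); (1,11); (1,15); (2,3); (2,5); (2,6); (3,4); (3,6); (3,7); (4,7); (4,8);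
   (4,9); (5,6); (5,11); (6,7); (7,10); (8,9); (8,12); (8,13); (9,13); (9,14); (10,11);
   (10,14); (10,15); (11,15); (12,13); (13,14); (14,15)]%nat
  [0; 0; 29163663; 0; 2383635; 9711760; 4767270; 19423520; 7150904; 29135280; 9602448;
   2791592; 11986083; 12503352; 14369718; 22215112; 15707913; 34309989; 15910837;
   24312048; 17355089; 12671132; 19601535; 2926724; 24264921; 39484697; 24467846;
   29486756; 24670770; 19488815; 26917217; 9744408]%Z.

Definition half31 : half := Half 17 3
  [(0,3); (0,5); (1,14); (1,16); (2,7); (2,10); (3,4); (3,5); (3,6); (4,6); (4,8); (4,9);
   (5,6); (5,7); (6,9); (7,10); (7,11); (8,12); (9,11); (9,12); (10,13); (10,14); (11,12);
   (11,15); (12,15); (13,14); (13,15); (13,16); (14,16); (15,16)]%nat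
  [0; 0; 42522196; 0; 12760536; 0; 3526714; 9357472; 7053429; 18714944; 9867166; 1624512;
   13393880; 10981984; 16141722; 9411035; 16278358; 22575084; 16920595; 20339456;
   22601324; 1777324; 24876039; 14280503; 26145524; 24199596; 28351146; 9958983; 32561760;
   888662; 34100968; 18140643; 38311582; 9070321]%Z.

Definition half34 : half := Half 18 2
  [(0,2); (0,5); (1,11); (1,15); (2,3); (2,5); (2,6); (3,4); (3,6); (3,7); (4,7); (4,8);
   (4,10); (5,6); (5,11); (6,11); (7,12); (7,13); (8,9); (8,10); (8,14); (9,14); (10,14);
   (10,17); (11,15); (12,13); (12,15); (12,16); (13,16); (13,17); (14,17); (15,16);
   (16,17)]%nat
  [0; 0; 20000000; 0; 182373; 9998337; 364745; 19996674; 7500000; 27002966; 8750000;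
   4841229; 8932373; 14839566; 10000000; 17320508; 12500000; 35663220; 17500000; 44323475;
   17500000; 27002966; 17500000; 9682458; 18567627; 12163400; 18750000; 22161737;
   22500000; 35663220; 27135255; 7006293; 27317627; 17004630; 27500000; 27002966]%Z.

Definition half35 : half := Half 19 3
  [(0,3); (0,6); (1,16); (1,18); (2,6); (2,12); (3,4); (3,5); (3,6); (4,5); (4,7); (4,8);
   (5,8); (5,9); (6,9); (7,10); (8,10); (8,11); (9,12); (9,14); (10,11); (10,13); (11,13);
   (11,14); (12,15); (12,16); (13,14); (13,17); (14,17); (15,16); (15,17); (15,18);
   (16,18); (17,18)]%nat
  [0; 0; 40222104; 0; 11027663; 0; (-4467920); 8946379; (-2547535); 18760253; 4991337;
   12190214; 5513831; 8342521; 5767357; 24315661; 6911721; 22004088; 14973088; 11586357;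
   15226613; 27559497; 15880292; 17580885; 20486919; 3243835; 24195184; 23136293;
   24848863; 13157681; 26825337; 10978462; 30354512; 1621918; 33163756; 18713089;
   36692930; 9356545]%Z.

Definition half36 : half := Half 19 2
  [(0,2); (0,4); (1,15); (1,18); (2,3); (2,4); (2,5); (3,5); (3,6); (3,7); (4,5); (4,8);
   (5,8); (6,7); (6,9); (6,10); (7,10); (7,12); (8,12); (8,15); (9,11); (9,14); (9,16);
   (10,12); (10,13); (11,13); (11,16); (11,17); (12,15); (13,17); (13,18); (14,16);
   (15,18); (16,17); (17,18)]%nat
  [0; 0; 39230499; 0; 3333810; 9427922; 6667621; 18855843; 9831725; 1826796; 13165535;
   11254718; 14385986; 25214054; 16033175; 15350648; 19663450; 3653593; 22044166;
   31644627; 23751540; 21708858; 24613842; 21980427; 25398729; 11845453; 27183517;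
   12316226; 29128772; 38702131; 29625448; 2782625; 31698447; 29037931; 34268122;
   19373731; 36837798; 9709530]%Z.

Definition half40 : half := Half 21 2
  [(0,2); (0,7); (1,17); (1,20); (2,3); (2,7); (2,8); (3,4); (3,8); (3,9); (4,5); (4,9);
   (4,10); (5,6); (5,10); (5,11); (6,11); (7,8); (7,12); (8,12); (9,13); (9,14); (10,11);
   (10,15); (11,15); (12,16); (12,17); (13,14); (13,15); (13,18); (14,18); (14,19);
   (15,18); (16,17); (16,19); (16,20); (17,20); (18,19); (19,20)]%nat
  [0; 0; 38028350; 0; 2068127; 9783806; 4136254; 19567611; 7496938; 28985987; 8214530;
   38960207; 8932122; 48934427; 9507088; 3100852; 11575214; 12884658; 13973148; 21366361;
   16493662; 33351644; 17211254; 43325864; 19014175; 6201705; 19731767; 29541831;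
   23932623; 20466986; 25490385; 37717301; 26453136; 12884658; 28521263; 3100852;
   29691241; 28642456; 33892097; 19567611; 35960223; 9783806]%Z.

Definition half41 : half := Half 22 3
  [(0,3); (0,9); (1,18); (1,21); (2,9); (2,14); (3,4); (3,8); (3,9); (4,5); (4,8); (4,10);
   (5,6); (5,10); (5,11); (6,7); (6,11); (6,12); (7,12); (8,10); (8,14); (9,14); (10,13);
   (11,12); (11,17); (12,17); (13,15); (13,17); (13,19); (14,18); (15,16); (15,19);
   (15,20); (16,18); (16,20); (16,21); (17,19); (18,21); (19,20); (20,21)]%nat
  [0; 0; 32979707; 0; 13752044; 0; (-2850092); 9585248; 0; 19170496; 2850092; 28755743;
   3265964; 38747092; 3681835; 48738441; 6876022; 11909620; 6876022; 7260876; 9726114;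
   21494868; 11710790; 33391262; 12126661; 43382611; 13889475; 30586975; 16602136;
   9585248; 16991530; 21080280; 20093585; 11573585; 20571487; 38026781; 23195640; 2066889;
   23673542; 28520086; 26775597; 19013391; 29877652; 9506695]%Z.

Theorem theorem3 :
  forall n : nat, In n (22 :: 30 :: 31 :: 34 :: 35 :: 36 :: 40 :: 41 :: nil)%nat ->
  exists (pos : nat -> point) (adj : nat -> nat -> bool),
    matchstick_graph n pos adj /\ regular_2_4 n adj /\ num_deg2 n adj = 2%nat.
Proof.
  intros n Hn. repeat (destruct Hn as [<-|Hn]); [..|destruct Hn].
  (* The literal 22 is convertible to [vertices half22]. *)
  - apply (half_realizes half22). vm_compute; reflexivity.
  - apply (half_realizes half30). vm_compute; reflexivity.
  - apply (half_realizes half31). vm_compute; reflexivity.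
  - apply (half_realizes half34). vm_compute; reflexivity.
  - apply (half_realizes half35). vm_compute; reflexivity.
  - apply (half_realizes half36). vm_compute; reflexivity.
  - apply (half_realizes half40). vm_compute; reflexivity.
  - apply (half_realizes half41). vm_compute; reflexivity.
Qed.
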